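(* Let $A$ be a finite cyclic group and $B$ a one-ended finitely presented group. If $\mathrm{Aut}(B)$ is finitely generated and if $B$ satisfies the Kaplansky unit conjecture over $A$, then $\mathrm{Out}(A \wr B)$ is finitely generated.
   Context: $A \wr B := \bigoplus_B A \rtimes B$ is the restricted wreath product, $B$ acting on $\bigoplus_B A$ by permuting the coordinates through left multiplication on $B$. The finite cyclic group $A$ is viewed as the ring $\mathbb{Z}/|A|\mathbb{Z}$, with unit group $A^\times$, and $A[B]$ is the group ring. $B$ satisfies the Kaplansky unit conjecture over $A$ if every unit of $A[B]$ is trivial, i.e. of the form $a\cdot b$ with $a\in A^\times$ and $b\in B$. *)

(* Defs.v *)
From HB Require Import structures.
From Stdlib Require Import Relation_Operators.
From mathcomp Require Import all_boot all_fingroup all_algebra all_solvable.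
From mathcomp Require Import finmap.
From mathcomp Require Import boolp classical_sets cardinality.

Set Implicit Arguments.
Unset Strict Implicit.
Unset Printing Implicit Defensive.

Local Open Scope classical_set_scope.
Local Open Scope group_scope.

Section Generation.
Variable G : groupType.

Definition subgroup (H : set G) : Prop :=
  H 1 /\ (forall x y : G, H x -> H y -> H (x * y^-1)).

Definition gen_subgroup (S : set G) : set G := smallest subgroup S.

Definition finitely_generated : Prop :=
  exists2 S : set G, finite_set S & gen_subgroup S = setT.

End Generation.

(* A word in the alphabet X and formal inverses: (x, false) stands for x and
   (x, true) for x^-1. *)
Definition word (X : Type) := seq (X * bool).

Definition eval_word (X : Type) (G : groupType) (gen : X -> G) (w : word X) : G :=
  foldr (fun l z => (if l.2 then (gen l.1)^-1 else gen l.1) * z) 1 w.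

(* The congruence on words whose quotient is the group < X | rels >. *)
Inductive pres_eq (X : Type) (rels : set (word X)) : word X -> word X -> Prop :=
| pres_refl w : pres_eq rels w w
| pres_sym v w : pres_eq rels v w -> pres_eq rels w v
| pres_trans u v w : pres_eq rels u v -> pres_eq rels v w -> pres_eq rels u w
| pres_cat v v' w w' :
    pres_eq rels v v' -> pres_eq rels w w' -> pres_eq rels (v ++ w) (v' ++ w')
| pres_cancel x e : pres_eq rels [:: (x, e); (x, ~~ e)] [::]
| pres_rel r : rels r -> pres_eq rels r [::].

(* G is isomorphic, via gen, to < 'I_n | rels >: the morphism from the free
   group is onto and its kernel is the normal closure of rels. *)
Definition finitely_presented (G : groupType) : Prop :=
  exists (n : nat) (gen : 'I_n -> G) (rels : set (word 'I_n)),
    [/\ finite_set rels, gen_subgroup (range gen) = setT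
      & forall w : word 'I_n, eval_word gen w = 1 <-> pres_eq rels w [::] ].

Section Ends.
Variables (G : groupType) (S : set G).

Definition cayley_adj (x y : G) : Prop :=
  exists2 s, S s & y = x * s \/ x = y * s.

Definition connected_off (K : set G) : G -> G -> Prop :=
  clos_refl_trans G (fun x y => [/\ ~ K x, ~ K y & cayley_adj x y]).

Definition component_off (K C : set G) : Prop :=
  exists2 x, ~ K x & C = [set y | connected_off K x y].

End Ends.

(* The choice of the finite generating set S does not matter. *)
Definition one_ended (G : groupType) : Prop :=
  exists S : set G,
    [/\ finite_set S, gen_subgroup S = setT
      & forall K : set G, finite_set K ->
          exists! C : set G, component_off S K C /\ infinite_set C].

Section Automorphisms.
Variable G : groupType.

Definition is_aut (f : G -> G) : Prop :=
  {morph f : x y / x * y} /\ bijective f.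

Record autgrp := MkAut { aut_fun :> G -> G; _ : `[< is_aut aut_fun >] }.

HB.instance Definition _ := [isSub for aut_fun].
HB.instance Definition _ := [Choice of autgrp by <:].

Lemma autM (f : autgrp) : {morph f : x y / x * y}.
Proof. by case: f => f /= /asboolP[]. Qed.

Lemma aut_bij (f : autgrp) : bijective f.
Proof. by case: f => f /= /asboolP[]. Qed.

Lemma autP (f g : autgrp) : f =1 g -> f = g.
Proof. by move=> fg; apply: val_inj; apply/funext. Qed.

Definition mk_aut (f : G -> G) (hf : is_aut f) : autgrp := MkAut (asboolT hf).

Lemma is_aut_id : is_aut id.
Proof. by split=> //; exists id. Qed.

Lemma is_aut_comp (f g : autgrp) : is_aut (f \o g).
Proof.
split=> [x y /=|]; first by rewrite !autM.
exact: bij_comp (aut_bij f) (aut_bij g).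
Qed.

Lemma aut_inv_ex (f : autgrp) : exists h : G -> G, cancel f h /\ cancel h f.
Proof. by case: (aut_bij f) => h fK hK; exists h. Qed.

Lemma is_aut_inv (f : autgrp) : is_aut (projT1 (cid (aut_inv_ex f))).
Proof.
case: cid => h [fK hK] /=; split; last by exists f.
by move=> x y; rewrite -{1}[x]hK -{1}[y]hK -autM fK.
Qed.

Definition aut_one : autgrp := mk_aut is_aut_id.
Definition aut_mul (f g : autgrp) : autgrp := mk_aut (is_aut_comp f g).
Definition aut_inv (f : autgrp) : autgrp := mk_aut (is_aut_inv f).

Lemma aut_mulA : associative aut_mul.
Proof. by move=> f g h; apply: autP. Qed.
Lemma aut_mul1 : left_id aut_one aut_mul.
Proof. by move=> f; apply: autP. Qed.
Lemma aut_mulr1 : right_id aut_one aut_mul.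
Proof. by move=> f; apply: autP. Qed.
Lemma aut_mulV : left_inverse aut_one aut_inv aut_mul.
Proof. by move=> f; apply: autP => x /=; case: cid => h []. Qed.
Lemma aut_mulrV : right_inverse aut_one aut_inv aut_mul.
Proof. by move=> f; apply: autP => x /=; case: cid => h []. Qed.

HB.instance Definition _ :=
  isGroup.Build autgrp aut_mulA aut_mul1 aut_mulr1 aut_mulV aut_mulrV.

Lemma autME (f g : autgrp) x : (f * g) x = f (g x). Proof. by []. Qed.

Definition inner (f : autgrp) : Prop :=
  exists g : G, forall x, f x = g * x * g^-1.

Lemma inner1 : inner 1.
Proof. by exists 1 => x; rewrite mul1g invg1 mulg1. Qed.

Lemma innerM f g : inner f -> inner g -> inner (f * g).
Proof.
by move=> [a ha] [b hb]; exists (a * b) => x; rewrite autME hb ha invgM !mulgA.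
Qed.

Lemma innerV f : inner f -> inner f^-1.
Proof.
move=> [a ha]; exists a^-1 => x; apply: (bij_inj (aut_bij f)).
by rewrite -autME mulgV ha invgK !mulgA mulgV mul1g mulgK.
Qed.

Lemma innerJ (f h : autgrp) : inner f -> inner (h^-1 * f * h).
Proof.
move=> [a ha]; exists (h^-1 a) => x; rewrite autME autME ha !autM -autME mulVg.
congr (_ * _); apply: (@mulgI _ (h^-1 a)); rewrite mulgV -autM mulgV.
by apply: (@mulgI _ (h^-1 1)); rewrite -autM !mulg1.
Qed.

Definition out_eq (f g : autgrp) : bool := `[< inner (f^-1 * g) >].

Lemma out_eq_refl : reflexive out_eq.
Proof. by move=> f; apply/asboolP; rewrite mulVg; exact: inner1. Qed.

Lemma out_eq_sym : symmetric out_eq.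
Proof.
move=> f g; apply/asboolP/asboolP => /innerV; by rewrite invgM invgK.
Qed.

Lemma out_eq_trans : transitive out_eq.
Proof.
move=> g f h /asboolP fg /asboolP gh; apply/asboolP.
by have := innerM fg gh; rewrite mulgA mulgK.
Qed.

Canonical out_equiv := EquivRel out_eq out_eq_refl out_eq_sym out_eq_trans.

Definition outgrp := {eq_quot out_equiv}%qT.
HB.instance Definition _ := Choice.on outgrp.
HB.instance Definition _ := EqQuotient.on outgrp.

Local Notation cls := (\pi_outgrp%qT).
Local Notation repr := generic_quotient.repr.
Implicit Types f g : autgrp.
Lemma cls_eq f g : inner (f^-1 * g) -> cls f = cls g.
Proof. by move=> fg; apply/eqmodP/asboolP. Qed.

Lemma cls_inner f g : cls f = cls g -> inner (f^-1 * g).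
Proof. by move=> /eqmodP/asboolP. Qed.

Lemma cls_surj (u : outgrp) : exists f, u = cls f.
Proof. by exists (repr u); rewrite reprK. Qed.

Definition out_one : outgrp := cls 1.
Definition out_mul (u v : outgrp) : outgrp := cls (repr u * repr v).
Definition out_inv (u : outgrp) : outgrp := cls (repr u)^-1.

Lemma out_mulE f g : out_mul (cls f) (cls g) = cls (f * g).
Proof.
apply: cls_eq.
have hf : inner ((repr (cls f))^-1 * f) by apply: cls_inner; rewrite reprK.
have hg : inner ((repr (cls g))^-1 * g) by apply: cls_inner; rewrite reprK.
move: (repr (cls f)) (repr (cls g)) hf hg => f' g' hf hg.
have := innerM hg (innerJ g hf).
by rewrite invgM !mulgA mulgK.
Qed.

Lemma out_invE f : out_inv (cls f) = cls f^-1.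
Proof.
apply: cls_eq; rewrite invgK.
have hf : inner ((repr (cls f))^-1 * f) by apply: cls_inner; rewrite reprK.
move: (repr _) hf => f' /innerV /(innerJ f'^-1).
by rewrite !invgM !invgK !mulgA mulgK.
Qed.

Lemma out_mulA : associative out_mul.
Proof.
move=> u v w; case: (cls_surj u) (cls_surj v) (cls_surj w) => f -> [g ->] [h ->].
by rewrite !out_mulE mulgA.
Qed.
Lemma out_mul1 : left_id out_one out_mul.
Proof. by move=> u; case: (cls_surj u) => f ->; rewrite out_mulE mul1g. Qed.
Lemma out_mulr1 : right_id out_one out_mul.
Proof. by move=> u; case: (cls_surj u) => f ->; rewrite out_mulE mulg1. Qed.
Lemma out_mulV : left_inverse out_one out_inv out_mul.
Proof. by move=> u; case: (cls_surj u) => f ->; rewrite out_invE out_mulE mulVg. Qed.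
Lemma out_mulrV : right_inverse out_one out_inv out_mul.
Proof. by move=> u; case: (cls_surj u) => f ->; rewrite out_invE out_mulE mulgV. Qed.

HB.instance Definition _ :=
  isGroup.Build outgrp out_mulA out_mul1 out_mulr1 out_mulV out_mulrV.

End Automorphisms.

Section Wreath.
Variables A B : groupType.

Local Notation base := {fsfun B -> A with 1}.

Definition base_mul (f g : base) : base :=
  [fsfun x in (finsupp f `|` finsupp g)%fset => f x * g x | 1].
Definition base_inv (f : base) : base :=
  [fsfun x in finsupp f => (f x)^-1 | 1].
Definition base_act (b : B) (f : base) : base :=
  [fsfun x in [fset b * y | y in finsupp f]%fset => f (b^-1 * x) | 1].

Lemma base_mulE f g x : base_mul f g x = f x * g x.
Proof.
rewrite fsfunE in_fsetU; case: finsuppP => // _; case: finsuppP => //= _.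
by rewrite mulg1.
Qed.

Lemma base_invE f x : base_inv f x = (f x)^-1.
Proof. by rewrite fsfunE; case: finsuppP => //; rewrite invg1. Qed.

Lemma base_actE b f x : base_act b f x = f (b^-1 * x).
Proof.
rewrite fsfunE; case: ifPn => // xN; case: finsuppP => // hx.
by case/negP: xN; apply/imfsetP; exists (b^-1 * x) => //=; rewrite mulgA mulgV mul1g.
Qed.

Record wreath := Wreath { lamps : base; cursor : B }.

Definition wreath_pair (u : wreath) : base * B := (lamps u, cursor u).
Definition wreath_of (u : base * B) : wreath := Wreath u.1 u.2.
Lemma wreath_pairK : cancel wreath_pair wreath_of.
Proof. by case. Qed.
HB.instance Definition _ := Choice.copy wreath (can_type wreath_pairK).

Definition wreath_one : wreath := Wreath [fsfun with 1] 1.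
Definition wreath_mul (u v : wreath) : wreath :=
  Wreath (base_mul (lamps u) (base_act (cursor u) (lamps v)))
         (cursor u * cursor v).
Definition wreath_inv (u : wreath) : wreath :=
  Wreath (base_act (cursor u)^-1 (base_inv (lamps u))) (cursor u)^-1.

Lemma wreathP (u v : wreath) :
  lamps u =1 lamps v -> cursor u = cursor v -> u = v.
Proof. by case: u v => [f b] [g c] /= /fsfunP -> ->. Qed.

Lemma wreath_mulA : associative wreath_mul.
Proof.
move=> u v w; apply: wreathP => [x|] /=; last by rewrite mulgA.
by rewrite !(base_mulE, base_actE) invgM !mulgA.
Qed.
Lemma wreath_mul1 : left_id wreath_one wreath_mul.
Proof.
move=> u; apply: wreathP => [x|] /=; last by rewrite mul1g.
by rewrite !(base_mulE, base_actE) fsfunE invg1 !mul1g.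
Qed.
Lemma wreath_mulr1 : right_id wreath_one wreath_mul.
Proof.
move=> u; apply: wreathP => [x|] /=; last by rewrite mulg1.
by rewrite !(base_mulE, base_actE) fsfunE mulg1.
Qed.
Lemma wreath_mulV : left_inverse wreath_one wreath_inv wreath_mul.
Proof.
move=> u; apply: wreathP => [x|] /=; last by rewrite mulVg.
by rewrite !(base_mulE, base_actE, base_invE) fsfunE mulVg.
Qed.
Lemma wreath_mulrV : right_inverse wreath_one wreath_inv wreath_mul.
Proof.
move=> u; apply: wreathP => [x|] /=; last by rewrite mulgV.
by rewrite !(base_mulE, base_actE, base_invE) fsfunE invgK mulgA mulgV mul1g mulgV.
Qed.

HB.instance Definition _ := isGroup.Build wreath
  wreath_mulA wreath_mul1 wreath_mulr1 wreath_mulV wreath_mulrV.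

End Wreath.

Import GRing.Theory.

Section GroupRing.
Variables (R : pzRingType) (B : groupType).

Definition group_ring := {fsfun B -> R with 0%R}.
HB.instance Definition _ := Choice.on group_ring.

Implicit Types u v w : group_ring.

Definition gr_zero : group_ring := [fsfun with 0%R].
Definition gr_single (a : R) (b : B) : group_ring :=
  [fsfun x in [fset b]%fset => a | 0%R].
Definition gr_opp u : group_ring := [fsfun x in finsupp u => (- u x)%R | 0%R].
Definition gr_add u v : group_ring :=
  [fsfun x in (finsupp u `|` finsupp v)%fset => (u x + v x)%R | 0%R].
Definition gr_mul u v : group_ring :=
  [fsfun x in [fset (y * z)%g | y in finsupp u, z in finsupp v]%fset =>
     (\sum_(y <- finsupp u) u y * v (y^-1 * x)%g)%R | 0%R].

Lemma grP u v : (u : B -> R) =1 v -> u = v.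
Proof. by move/fsfunP. Qed.

Lemma gr_zeroE x : gr_zero x = 0%R.
Proof. by rewrite fsfunE. Qed.

Lemma gr_singleE a b x : gr_single a b x = if x == b then a else 0%R.
Proof. by rewrite fsfunE in_fset1. Qed.

Lemma gr_oppE u x : gr_opp u x = (- u x)%R.
Proof. by rewrite fsfunE; case: finsuppP => //; rewrite oppr0. Qed.

Lemma gr_addE u v x : gr_add u v x = (u x + v x)%R.
Proof.
rewrite fsfunE in_fsetU; case: finsuppP => // _; case: finsuppP => //= _.
by rewrite addr0.
Qed.

Lemma gr_sum_widen u (S : {fset B}) (F : B -> R) : (finsupp u `<=` S)%fset ->
  (\sum_(y <- finsupp u) u y * F y = \sum_(y <- S) u y * F y)%R.
Proof.
move=> uS; apply: big_fset_incl => // y _ yN.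
by rewrite fsfun_dflt // mul0r.
Qed.

Lemma gr_mulE u v x :
  gr_mul u v x = (\sum_(y <- finsupp u) u y * v (y^-1 * x)%g)%R.
Proof.
rewrite fsfunE; case: ifPn => // xN; rewrite big_seq big1 // => y yu.
rewrite [v _]fsfun_dflt ?mulr0 //; apply/negP => hv; case/negP: xN.
by apply/imfset2P; exists y => //; exists (y^-1 * x)%g => //; rewrite mulgA mulgV mul1g.
Qed.

Lemma gr_mulE_in u v x (S : {fset B}) : (finsupp u `<=` S)%fset ->
  gr_mul u v x = (\sum_(y <- S) u y * v (y^-1 * x)%g)%R.
Proof. by move=> uS; rewrite gr_mulE (gr_sum_widen _ uS). Qed.

Lemma gr_addA : associative gr_add.
Proof. by move=> u v w; apply: grP => x; rewrite !gr_addE addrA. Qed.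
Lemma gr_addC : commutative gr_add.
Proof. by move=> u v; apply: grP => x; rewrite !gr_addE addrC. Qed.
Lemma gr_add0 : left_id gr_zero gr_add.
Proof. by move=> u; apply: grP => x; rewrite !gr_addE gr_zeroE add0r. Qed.
Lemma gr_addN : left_inverse gr_zero gr_opp gr_add.
Proof. by move=> u; apply: grP => x; rewrite gr_addE gr_oppE gr_zeroE addNr. Qed.

HB.instance Definition _ :=
  GRing.isZmodule.Build group_ring gr_addA gr_addC gr_add0 gr_addN.

Lemma gr_mulA : associative gr_mul.
Proof.
move=> u v w; apply: grP => x.
rewrite (gr_mulE u) (gr_mulE (gr_mul u v)).
transitivity (\sum_(y <- finsupp u) \sum_(z <- finsupp v)
   u y * (v z * w (z^-1 * (y^-1 * x))%g))%R.
  by apply: eq_bigr => y _; rewrite gr_mulE mulr_sumr.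
pose T := [fset (y * z)%g | y in finsupp u, z in finsupp v]%fset.
have sT : (finsupp (gr_mul u v) `<=` T)%fset by exact: finsupp_sub.
rewrite (gr_sum_widen (fun t => w (t^-1 * x)%g) sT).
transitivity (\sum_(t <- T) \sum_(y <- finsupp u)
   u y * (v (y^-1 * t)%g * w (t^-1 * x)%g))%R; last first.
  apply: eq_bigr => t _; rewrite gr_mulE mulr_suml.
  by apply: eq_bigr => y _; rewrite mulrA.
rewrite [RHS]exchange_big /= [LHS]big_seq [RHS]big_seq; apply: eq_bigr => y yu.
pose T' := [fset (y * z)%g | z in finsupp v]%fset.
have T'T : (T' `<=` T)%fset.
  apply/fsubsetP => _ /imfsetP[z zv ->]; apply/imfset2P.
  by exists y => //; exists z.
rewrite -(big_fset_incl _ T'T) /=; last first.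
  move=> t _ tN; rewrite [v _]fsfun_dflt ?mul0r ?mulr0 //.
  apply/negP => h; case/negP: tN; apply/imfsetP; exists (y^-1 * t)%g => //.
  by rewrite mulgA mulgV mul1g.
rewrite big_imfset /=; last by move=> a b _ _; exact: mulgI.
by apply: eq_bigr => z _; rewrite !mulgA mulVg mul1g invgM ?mulgA.
Qed.

Definition gr_one : group_ring := gr_single 1%R 1%g.

Lemma gr_mul1 : left_id gr_one gr_mul.
Proof.
move=> u; apply: grP => x.
rewrite (@gr_mulE_in _ _ _ [fset 1%g]%fset); last exact: finsupp_sub.
by rewrite big_seq_fset1 gr_singleE eqxx mul1r invg1 mul1g.
Qed.

Lemma gr_mulr1 : right_id gr_one gr_mul.
Proof.
move=> u; apply: grP => x.
rewrite (@gr_mulE_in _ _ _ (x |` finsupp u)%fset); last exact: fsubsetUr.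
rewrite (big_fsetD1 x) /=; last exact: fset1U1.
rewrite big_seq big1 => [|y].
  by rewrite gr_singleE mulVg eqxx mulr1 addr0.
rewrite in_fsetD1 gr_singleE => /andP[yx _].
case: eqP => [/(congr1 (mulg y))|]; last by rewrite mulr0.
by rewrite mulgA mulgV mul1g mulg1 => xy; rewrite xy eqxx in yx.
Qed.

Lemma gr_mulDl : left_distributive gr_mul +%R.
Proof.
move=> u v w; apply: grP => x; rewrite gr_addE.
pose S := (finsupp u `|` finsupp v)%fset.
rewrite (@gr_mulE_in (u + v)%R _ _ S); last exact: finsupp_sub.
rewrite (@gr_mulE_in u _ _ S) ?fsubsetUl // (@gr_mulE_in v _ _ S) ?fsubsetUr //.
by rewrite -big_split /=; apply: eq_bigr => y _; rewrite gr_addE mulrDl.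
Qed.

Lemma gr_mulDr : right_distributive gr_mul +%R.
Proof.
move=> u v w; apply: grP => x; rewrite gr_addE !gr_mulE -big_split /=.
by apply: eq_bigr => y _; rewrite gr_addE mulrDr.
Qed.

HB.instance Definition _ := GRing.Zmodule_isPzRing.Build group_ring
  gr_mulA gr_mul1 gr_mulr1 gr_mulDl gr_mulDr.

End GroupRing.

Definition invertible (R : pzRingType) (u : R) : Prop :=
  exists v : R, (u * v = 1 /\ v * u = 1)%R.

Definition kaplansky_unit (R : pzRingType) (B : groupType) : Prop :=
  forall u : group_ring R B, invertible u ->
    exists (a : R) (b : B), invertible a /\ u = gr_single a b.

(* Z/nZ for n > 0, including the zero ring Z/1Z (which 'Z_n excludes). *)
Definition Zmodn (n : nat) := 'I_n.-1.+1.

HB.instance Definition _ n := GRing.Zmodule.on (Zmodn n).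
HB.instance Definition _ n := GRing.Zmodule_isComPzRing.Build (Zmodn n)
  (@Zp_mulA _) (@Zp_mulC _) (@Zp_mul1z _) (@Zp_mul_addl _).

(* Main.v *)
From Stdlib Require Import Relation_Operators.
Require Import Defs.
From mathcomp Require Import all_boot all_fingroup all_algebra all_solvable.
From mathcomp Require Import finmap.
From mathcomp Require Import boolp classical_sets cardinality.

Set Implicit Arguments.
Unset Strict Implicit.
Unset Printing Implicit Defensive.

Local Open Scope classical_set_scope.
Local Open Scope group_scope.

(** Write [W] for the wreath product and [M] for its base, which is the free
    module of rank one over the group ring of [B] with coefficients in the
    integers modulo the order of [A].  The proof shows that every automorphism
    of [W] is, up to an inner one, the automorphism [wreath_aut al be] made of
    an automorphism of [A] and one of [B].  So [Out W] is a quotient of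
    the direct product of [Aut A] and [Aut B], and it is finitely generated because [Aut A] is finite and
    [Aut B] finitely generated.

    Let [phi] be an automorphism of [W].  First, [phi] preserves [M]
    ([base_characteristic]).  If an abelian normal subgroup contains an element
    acting on [M] through some [b <> 1] of [B], then [(1 - b)^2 = 0] in the
    group ring.  This already excludes everything except lamps of exponent 2
    and an involution [b], and that case is excluded because [b] would be
    central in [B], whereas [W] modulo the image of [M], again isomorphic to
    [B], would have trivial centre.

    Hence [phi] induces an automorphism of [B].  After composing with the
    inverse of its lift to [W], [phi] differs on [B] from the identity by a
    cocycle with values in [M].  Cocycles correspond to functions on [B] that
    each translation changes at finitely many points only; on a one-ended group
    such a function is almost constant ([almost_invariant_almost_constant]), so
    the cocycle is principal ([section_conjugate]) and [phi] may be corrected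
    by an inner automorphism to fix [B] pointwise.

    What remains is an automorphism of the module [M], that is, right
    multiplication by a unit of the group ring.  By hypothesis the unit is
    [k b] with [k] invertible and [b] in [B]: the factor [k] is an automorphism
    of [A], and right translation by [b] is, up to conjugation by [b] in [W],
    the lift of an inner automorphism of [B] ([kaplansky_aut]). *)

(** * Generation and ends *)

Lemma generation_ind (G : groupType) (S H : set G) :
  gen_subgroup S = setT -> subgroup H -> S `<=` H -> forall x, H x.
Proof.
move=> genS sgH SH x; have : gen_subgroup S x by rewrite genS.
by move/(smallest_sub sgH SH).
Qed.

Lemma one_ended_infinite (G : groupType) :
  one_ended G -> infinite_set [set: G].
Proof.
case=> S [_ _ endS].
have [C [[_ infC] _]] := endS set0 (finite_set0 _).
by apply: sub_infinite_set infC => x.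
Qed.

Lemma connected_off_avoids (G : groupType) (S K : set G) x y :
  connected_off S K x y -> ~ K x -> ~ K y.
Proof. by elim=> [? ? [] //|//|? ? ? _ IHx _ IHy /IHx]. Qed.

(** The points where an edge of the Cayley graph changes the value of [h] form
    a finite set [K], so [h] is constant on every component off [K].  One
    component [C] is infinite.  Every other component is finite and, the
    Cayley graph being connected, contains a neighbour of [K]; as [K] has
    finitely many neighbours, the complement of [C] is finite. *)
Lemma almost_invariant_almost_constant (G : groupType) (T : Type) (h : G -> T) :
  one_ended G ->
  (forall s, finite_set [set x | h (x * s) <> h x]) ->
  exists t, finite_set [set x | h x <> t].
Proof.
case=> S [finS genS endS] hS.
pose K := \bigcup_(s in S) [set x | h (x * s) <> h x].
have finK : finite_set K by apply: bigcup_finite.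
have [C [[[c cK CE] infC] Cuniq]] := endS K finK.
have hconst x y : connected_off S K x y -> h y = h x.
  elim=> [u v [uK vK [s Ss [vE|uE]]]|//|u v w _ -> _ -> //].
    by rewrite vE; apply: contrapT => hu; apply: uK; exists s.
  by rewrite uE; apply: contrapT => hv; apply: vK; exists s => //= /esym.
pose nbr := \bigcup_(s in S) ([set k * s | k in K] `|` [set k * s^-1 | k in K]).
have finnbr : finite_set nbr.
  apply: bigcup_finite => // s _.
  by rewrite finite_setU; split; apply: finite_image.
pose comp x : set G := [set y | connected_off S K x y].
pose small := [set y | [/\ nbr y, ~ K y & finite_set (comp y)]].
have finsmall : finite_set small by apply: sub_finite_set finnbr => y [].
pose D := K `|` C `|` \bigcup_(y in small) comp y.
have Dadj x y : D x -> cayley_adj S x y -> D y.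
  move=> Dx xy; have [yK|yK] := pselect (K y); first by left; left.
  have step z : ~ K z -> connected_off S K z x -> connected_off S K z y.
    move=> zK zx; apply: rt_trans (zx) _; apply: rt_step.
    by split=> //; apply: connected_off_avoids zx zK.
  case: Dx => [[xK|Cx]|[z smallz zx]].
  - have nbry : nbr y.
      case: xy => s Ss [yE|xE]; exists s => //; [left|right]; exists x => //.
      by rewrite xE mulgK.
    have [finy|infy] := pselect (finite_set (comp y)).
      by right; exists y => //; apply: rt_refl.
    left; right; suff -> : C = comp y by apply: rt_refl.
    by apply: Cuniq; split => //; exists y.
  - by left; right; move: Cx; rewrite CE; apply: step.
  - by right; exists z => //; apply: step zx; case: smallz.
have Dall x : D x.
  have gstab : forall g, (forall x, D x -> D (x * g)) /\
                         (forall x, D x -> D (x * g^-1)).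
    apply: (generation_ind genS) => [|s Ss].
      split=> [|a b [aD aVD] [bD bVD]]; first by rewrite invg1; split=> z; rewrite mulg1.
      split=> z Dz; first by rewrite mulgA; apply/bVD/aD.
      by rewrite invgM invgK mulgA; apply/aVD/bD.
    split=> z Dz; apply: Dadj Dz _; exists s => //; first by left.
    by right; rewrite mulgVK.
  have Dc : D c by left; right; rewrite CE; apply: rt_refl.
  by have := (gstab (c^-1 * x)).1 c Dc; rewrite mulVKg.
exists (h c).
apply: (@sub_finite_set _ _ (K `|` \bigcup_(y in small) comp y)).
  move=> x hx; case: (Dall x) => [[Kx|Cx]|Sx]; [by left| |by right].
  by case: hx; apply: hconst; move: Cx; rewrite CE.
rewrite finite_setU; split=> //.
by apply: bigcup_finite => // y [].
Qed.

(** * Automorphisms *)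

Section Aut.
Variable G : groupType.
Implicit Types f g : autgrp G.

Lemma aut1 f : f 1 = 1.
Proof. by apply: (@mulgI _ (f 1)); rewrite -autM !mulg1. Qed.

Lemma autV f x : f x^-1 = (f x)^-1.
Proof. by apply: (@mulgI _ (f x)); rewrite -autM !mulgV aut1. Qed.

Lemma autK f x : f^-1 (f x) = x.
Proof. by rewrite -autME mulVg. Qed.

Lemma autVK f x : f (f^-1 x) = x.
Proof. by rewrite -autME mulgV. Qed.

Lemma is_aut_conj (z : G) : is_aut (fun x => z * x * z^-1).
Proof.
split=> [x y|]; first by rewrite !mulgA mulgVK.
by exists (fun x => z^-1 * x * z) => x; rewrite !mulgA ?mulVg ?mulgV mul1g ?mulgK ?mulgVK.
Qed.

Definition inner_aut (z : G) : autgrp G := mk_aut (is_aut_conj z).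

Lemma inner_autV z : inner_aut z^-1 = (inner_aut z)^-1.
Proof.
apply: autP => x; apply: (bij_inj (aut_bij (inner_aut z))); rewrite autVK /=.
by rewrite invgK !mulgA mulgV mul1g mulgK.
Qed.

Definition out f : outgrp G := (\pi_(outgrp G) f)%qT.

Lemma outM f g : out (f * g) = out f * out g.
Proof. by rewrite /out -out_mulE. Qed.

Lemma out1 : out 1 = 1.
Proof. by []. Qed.

Lemma out_inner_aut z : out (inner_aut z) = 1.
Proof.
by rewrite -out1; apply: cls_eq; rewrite mulg1; apply: innerV; exists z.
Qed.

End Aut.

(** * The base subgroup of a wreath product *)

Section WreathBasics.
Variables A B : groupType.
Local Notation base := {fsfun B -> A with 1}.
Local Notation W := (wreath A B).
Implicit Types (u v w : W) (f : base).

Definition of_base f : W := Wreath f 1.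
Definition of_cursor (b : B) : W := Wreath [fsfun with 1] b.
Definition toggle (a : A) (x : B) : base := [fsfun y in [fset x]%fset => a | 1].

Lemma toggleE a x y : toggle a x y = if y == x then a else 1.
Proof. by rewrite fsfunE in_fset1. Qed.

Lemma base1E (x : B) : ([fsfun with 1] : base) x = 1.
Proof. by rewrite fsfunE. Qed.

Lemma cursorM u v : cursor (u * v) = cursor u * cursor v. Proof. by []. Qed.
Lemma cursorV u : cursor u^-1 = (cursor u)^-1. Proof. by []. Qed.

Lemma lamps1 x : lamps (1 : W) x = 1.
Proof. exact: base1E. Qed.

Lemma lampsM u v x : lamps (u * v) x = lamps u x * lamps v ((cursor u)^-1 * x).
Proof. by rewrite base_mulE base_actE. Qed.

Lemma lampsV u x : lamps u^-1 x = (lamps u (cursor u * x))^-1.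
Proof. by rewrite base_actE base_invE invgK. Qed.

Definition wreathE :=
  (lampsM, lampsV, lamps1, cursorM, cursorV, base1E).

Lemma wreath_decomp u : u = of_base (lamps u) * of_cursor (cursor u).
Proof. by apply: wreathP => [x|]; rewrite !wreathE /= ?base1E ?mulg1 ?mul1g. Qed.

Lemma of_baseK u : cursor u = 1 -> of_base (lamps u) = u.
Proof. by case: u => f b /= ->. Qed.

Lemma of_baseM f g : of_base (base_mul f g) = of_base f * of_base g.
Proof.
apply: wreathP => [x|]; last by rewrite !wreathE mulg1.
by rewrite !wreathE /= base_mulE invg1 mul1g.
Qed.

Lemma of_cursorM b c : of_cursor (b * c) = of_cursor b * of_cursor c.
Proof. by apply: wreathP => [x|]; rewrite !wreathE //= ?base1E mul1g. Qed.

Lemma of_cursorV b : of_cursor b^-1 = (of_cursor b)^-1.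
Proof. by apply: wreathP => [x|]; rewrite !wreathE //= ?base1E invg1. Qed.

Lemma toggle_conj a x b :
  of_base (toggle a (b * x)) = of_cursor b * of_base (toggle a x) * (of_cursor b)^-1.
Proof.
apply: wreathP => [y|]; last by rewrite !wreathE mulg1 mulgV.
rewrite !wreathE /= ?base1E invg1 mul1g mulg1 !toggleE.
by rewrite -[b^-1 * y == x](inj_eq (mulgI b)) mulVKg.
Qed.

Lemma base_ind (P : base -> Prop) :
  P [fsfun with 1] -> (forall a x f, P f -> P (base_mul (toggle a x) f)) ->
  forall f, P f.
Proof.
move=> P1 PM f.
have : forall y, y \notin (finsupp f : seq B) -> f y = 1 by move=> y /fsfun_dflt.
move: (finsupp f : seq B) => s; elim: s f => [|x s IHs] f fs.
  by suff -> : f = [fsfun with 1] by []; apply/fsfunP => y; rewrite base1E fs.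
have -> : f = base_mul (toggle (f x) x) (base_mul (toggle (f x)^-1 x) f).
  by apply/fsfunP => y; rewrite !base_mulE !toggleE; case: eqP => [->|_];
    rewrite ?mulVKg ?mul1g.
apply/PM/IHs => y ys; rewrite base_mulE toggleE; case: eqP => [->|yx].
  exact: mulVg.
by rewrite mul1g fs // in_cons negb_or ys andbT; apply/eqP.
Qed.

End WreathBasics.

Section CommutativeLamps.
Variables A B : groupType.
Hypothesis mulAC : commutative (fun a b : A => a * b).
Local Notation W := (wreath A B).
Implicit Types (u v w : W).

Lemma commute_base v w : cursor v = 1 ->
  (w * v = v * w <-> forall y, lamps v ((cursor w)^-1 * y) = lamps v y).
Proof.
move=> v1; split=> [wv y|inv].
  have := congr1 (fun u => lamps u y) wv.
  by rewrite !lampsM v1 invg1 mul1g mulAC => /mulIg.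
apply: wreathP => [y|]; last by rewrite !cursorM v1 mulg1 mul1g.
by rewrite !lampsM v1 invg1 mul1g mulAC inv.
Qed.

Lemma base_commute v w : cursor v = 1 -> cursor w = 1 -> w * v = v * w.
Proof. by move=> v1 w1; apply/commute_base => // y; rewrite w1 invg1 mul1g. Qed.

Local Notation toggle1 a := (of_base (toggle a (1 : B))).

Lemma lamps_commutator_toggle a w y :
  lamps (toggle1 a * w * (toggle1 a)^-1 * w^-1) y =
  toggle a 1 y * (toggle a (cursor w) y)^-1.
Proof.
rewrite !wreathE /= !(mul1g, invg1, mulg1) mulVKg !toggleE.
have -> : ((cursor w)^-1 * y == 1) = (y == cursor w).
  by rewrite -(inj_eq (mulgI (cursor w))) mulVKg mulg1.
by rewrite -!mulgA (mulAC (lamps w y)) mulgVK.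
Qed.

(** In the notation of group rings with [b] and [c] the two cursors: [u]
    commutes with the commutator exactly when [(1 - b) (1 - c) a = 0], and
    if neither [b] nor [c] is [1] then the coefficient [a] at [1] can only
    be cancelled by the term [b c]. *)
Lemma commute_commutator_toggle a u w : a <> 1 -> cursor u <> 1 ->
  let d := toggle1 a * w * (toggle1 a)^-1 * w^-1 in
  u * d = d * u -> cursor w = 1 \/ cursor w = (cursor u)^-1.
Proof.
move=> a1 u1 d; have d1 : cursor d = 1.
  by rewrite !wreathE /= invg1 mul1g mulg1 mulgV.
move=> /(commute_base _ d1)/(_ 1).
rewrite !lamps_commutator_toggle !toggleE mulg1 eqxx.
case: eqP => [/(congr1 (@monoid.inv _))|_]; first by rewrite invgK invg1 => /u1.
case: eqP => [->|_]; first by right.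
case: eqP => [->|_]; first by left.
by rewrite invg1 !mulg1 => aE; case: a1.
Qed.

(** The base subgroup is characteristic.  Let [N] be its image under [phi], an
    abelian normal subgroup equal to its own centralizer, and suppose [N]
    contains an element [phi u] with cursor [b <> 1].  Since [N] is normal
    and abelian, [commute_commutator_toggle] bounds the cursor of every
    element central modulo [N]: it is [1] or [b^-1].  On [phi u] this gives
    [b = b^-1]; on its conjugates, that [b] is central.  Hence [phi] maps
    [b] to an element central modulo [N] but outside [N]; correcting it by
    [phi u] if necessary, it becomes an element [g] of the base.  Then
    [(1 - b) g] is invariant under [B], hence zero because [B] is
    infinite.  So [g] commutes with [N], and lies in [N] after all. *)
Lemma base_characteristic (phi : autgrp W) u : infinite_set [set: B] ->
  cursor u = 1 -> cursor (phi u) = 1.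
Proof.
move=> infB u1; apply: contrapT => phiu1; set b := cursor (phi u) in phiu1.
have [a a1] : exists a : A, a <> 1.
  apply: contrapT => triv; apply: phiu1.
  suff u_1 : u = 1 by rewrite /b u_1 aut1.
  apply: wreathP => // x; rewrite lamps1; apply: contrapT => ux.
  by apply: triv; exists (lamps u x).
pose N w := cursor (phi^-1 w) = 1.
have Nu : N (phi u) by rewrite /N autK.
have Nab v w : N v -> N w -> v * w = w * v.
  by move=> Nv Nw; rewrite -[v](autVK phi) -[w](autVK phi) -!(autM phi) base_commute.
have NM v w : N v -> N w -> N (v * w).
  by rewrite /N autM cursorM => -> ->; rewrite mulg1.
have NJ m v : N v -> N (m * v * m^-1).
  by rewrite /N !autM autV !cursorM cursorV => ->; rewrite mulg1 mulgV.
have NR m v : N v -> N (m * v * m^-1 * v^-1).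
  move=> Nv; apply: NM (NJ _ _ Nv) _; move: Nv.
  by rewrite /N autV cursorV => ->; rewrite invg1.
have cursorN w : (forall m, N (m * w * m^-1 * w^-1)) ->
    cursor w = 1 \/ cursor w = b^-1.
  by move=> cen; apply: (commute_commutator_toggle a1 phiu1); apply: Nab.
have bV : b^-1 = b.
  by have [//|] := cursorN _ (fun m => NR m _ Nu).
have bC x : x * b = b * x.
  have := cursorN _ (fun m => NR m _ (NJ (of_cursor A x) _ Nu)).
  rewrite !wreathE -/b bV /= => -[/(congr1 (mulg^~ x))|/(congr1 (mulg^~ x))].
    rewrite mulgVK mul1g -{2}[x]mulg1 => /mulgI.
    by move/phiu1.
  by rewrite mulgVK.
have bC' x y : b * x * y = x * b * y by rewrite bC.
have [g [g1 gb]] : exists g, cursor g = 1 /\ cursor (phi^-1 g) = b.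
  have zb : cursor (phi^-1 (phi (of_cursor A b))) = b by rewrite autK.
  have [m|z1|zbV] := cursorN (phi (of_cursor A b)).
  - by rewrite /N !autM !autV !cursorM !cursorV zb bC mulgK mulgV.
  - by exists (phi (of_cursor A b)).
  exists (phi (of_cursor A b) * phi u); rewrite autM !cursorM zb zbV.
  by rewrite mulVg Nu mulg1.
have cenN m : N (m * g * m^-1 * g^-1).
  by rewrite /N !autM !autV !cursorM !cursorV gb bC mulgK mulgV.
(* F is (1 - b) g, written multiplicatively. *)
pose F y := lamps g y * (lamps g (b^-1 * y))^-1.
have Finv x y : F (x^-1 * y) = F y.
  pose d := of_cursor A x * g * (of_cursor A x)^-1 * g^-1.
  have d1 : cursor d = 1 by rewrite !cursorM !cursorV g1 mulg1 mulgV mul1g invg1.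
  have dE t : lamps d t = lamps g (x^-1 * t) * (lamps g t)^-1.
    by rewrite !wreathE g1 /= !(mul1g, invg1, mulg1, mulgV).
  have := (commute_base (phi u) d1).1 (Nab _ _ Nu (cenN _)) y.
  rewrite !dE -/b /F bV !mulgA -bC' => dby.
  have -> : lamps g (x^-1 * y) =
      lamps g (b * x^-1 * y) * (lamps g (b * y))^-1 * lamps g y.
    by rewrite dby mulgVK.
  by rewrite mulAC -!mulgA mulKg mulAC.
have F1 y : F y = 1.
  apply: contrapT => Fy; apply: infB.
  pose S := [set` finsupp (lamps g)].
  apply: (@sub_finite_set _ _ (S `|` [set b * t | t in S])); last first.
    by rewrite finite_setU; split; [|apply: finite_image]; apply: finite_fset.
  move=> x _; apply: contrapT => xS; apply: Fy.
  have -> : F y = F x by rewrite -(Finv (y * x^-1) y) invgM invgK mulgVK.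
  have out t : ~ S t -> lamps g t = 1 by move=> /negP/fsfun_dflt.
  rewrite /F !out ?mulgV // => Sx; apply: xS; [right|by left].
  by exists (b^-1 * x); rewrite ?mulVKg.
have ginv y : lamps g (b^-1 * y) = lamps g y.
  by apply: (@mulIg _ (lamps g (b^-1 * y))^-1); rewrite mulgV; apply/esym/F1.
have gN v : N v -> v * g = g * v.
  move=> Nv; apply/commute_base => // y.
  have [->|->] := cursorN v (fun m => NR m v Nv); last by rewrite bV ginv.
  by rewrite invg1 mul1g.
(* phi^-1 g commutes with the base although its cursor is b <> 1 *)
pose t : W := toggle1 a.
have : phi^-1 g * t = t * phi^-1 g.
  have /gN/(congr1 (phi^-1)) : N (phi t) by rewrite /N autK.
  by rewrite !autM autK.
move/(commute_base _ (erefl : cursor t = 1))/(_ 1); rewrite gb /= !toggleE eqxx.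
by rewrite mulg1 bV; case: eqP => // _ aE; case: a1.
Qed.

End CommutativeLamps.

(** * Automorphisms of wreath products *)

Section WreathAut.
Variables A B : groupType.
Local Notation base := {fsfun B -> A with 1}.
Local Notation W := (wreath A B).
Implicit Types (al : autgrp A) (be : autgrp B) (u v w : W).

Definition base_map al be (f : base) : base :=
  [fsfun x in [fset be y | y in finsupp f]%fset => al (f (be^-1 x)) | 1].

Lemma base_mapE al be f x : base_map al be f x = al (f (be^-1 x)).
Proof.
rewrite fsfunE; case: ifPn => // xN; case: finsuppP => [_|hx]; first by rewrite aut1.
by case/negP: xN; apply/imfsetP; exists (be^-1 x); rewrite ?autVK.
Qed.

Definition wreath_map al be u : W :=
  Wreath (base_map al be (lamps u)) (be (cursor u)).

Lemma is_aut_wreath_map al be : is_aut (wreath_map al be).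
Proof.
split=> [u v|].
  apply: wreathP => [x|]; last by rewrite /= autM.
  by rewrite lampsM /= !base_mapE lampsM !autM autV autK.
exists (wreath_map al^-1 be^-1) => u; apply: wreathP => [x|] /=;
  first [exact: autK | exact: autVK | by rewrite !(base_mapE, invgK, autK, autVK)].
Qed.

Definition wreath_aut al be : autgrp W := mk_aut (is_aut_wreath_map al be).

Lemma lamps_wreath_aut al be u x :
  lamps (wreath_aut al be u) x = al (lamps u (be^-1 x)).
Proof. exact: base_mapE. Qed.

Lemma wreath_autM al al' be be' :
  wreath_aut (al * al') (be * be') = wreath_aut al be * wreath_aut al' be'.
Proof.
apply: autP => u; apply: wreathP => // x.
by rewrite autME !lamps_wreath_aut invgM.
Qed.

Lemma wreath_aut1 : wreath_aut 1 1 = 1.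
Proof. by apply: (@mulgI _ (wreath_aut 1 1)); rewrite -wreath_autM !mulg1. Qed.

(** A section is a cocycle [c x y = lamps (sigma x) y], and every cocycle is
    the coboundary of a function on [B], namely of the diagonal
    [D y = c y y].  That [c x] has finite support makes [D] almost
    invariant, hence almost equal to a constant, and dividing by this
    constant gives an element of the base with the same coboundary. *)
Lemma section_conjugate (sigma : B -> W) : one_ended B ->
  {morph sigma : x y / x * y} -> (forall b, cursor (sigma b) = b) ->
  exists f : base, forall b,
    sigma b = of_base f * of_cursor A b * (of_base f)^-1.
Proof.
move=> endB sM sC; pose D y := lamps (sigma y) y.
have DE x y : D y = lamps (sigma x) y * D (x^-1 * y).
  by rewrite /D -{1}(mulVKg x y) sM lampsM sC.
have finV (S : set B) : finite_set S -> finite_set [set y | S y^-1].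
  move=> finS; apply: (@sub_finite_set _ _ [set y^-1 | y in S]).
    by move=> y Sy; exists y^-1; rewrite ?invgK.
  exact: finite_image.
(* The cocycle identity compares D at y and at s^-1 y, while edges of the
   Cayley graph are right translations; inversion exchanges the two sides. *)
have [t fint] : exists t, finite_set [set y | D y^-1 <> t].
  apply: (almost_invariant_almost_constant endB) => s.
  apply: (@sub_finite_set _ _ [set y | [set` finsupp (lamps (sigma s))] y^-1]).
    move=> y ys; apply: contrapT => /negP/fsfun_dflt yN; apply: ys.
    by rewrite invgM [RHS](DE s) yN mul1g.
  by apply: finV; apply: finite_fset.
have {}fint : finite_set [set y | D y <> t].
  apply: sub_finite_set (finV _ fint) => y; by rewrite /= invgK.
pose f : base := [fsfun y in fset_set [set y | D y <> t] => D y * t^-1 | 1].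
have fE y : f y = D y * t^-1.
  rewrite fsfunE in_fset_set //; case: ifPn => // /negP; rewrite inE /=.
  by move=> /contrapT ->; rewrite mulgV.
exists f => b; apply: wreathP => [y|]; last first.
  by rewrite !wreathE sC /= !(mul1g, invg1, mulg1).
rewrite !wreathE /= !(mul1g, invg1, mulg1) !fE (DE b y).
by rewrite invgM invgK !mulgA mulgVK mulgK.
Qed.

End WreathAut.

(** * Module automorphisms of the base as units of the group ring *)

Lemma gr_mul_singler (R : pzRingType) (B : groupType) (u : group_ring R B)
  (k : R) (b x : B) : (u * gr_single k b)%R x = (u (x * b^-1)%g * k)%R.
Proof.
have -> : (u * gr_single k b)%R x = gr_mul u (gr_single k b) x by [].
rewrite (@gr_mulE_in _ _ _ _ _ ((x * b^-1)%g |` finsupp u)%fset); last first.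
  exact: fsubsetUr.
rewrite (big_fsetD1 (x * b^-1)%g) /=; last exact: fset1U1.
rewrite big_seq big1 => [|y].
  by rewrite gr_singleE invgM invgK -mulgA mulVg mulg1 eqxx GRing.addr0.
rewrite in_fsetD1 gr_singleE => /andP[yx _].
case: eqP => [xy|]; last by rewrite GRing.mulr0.
by rewrite -xy invgM invgK mulVKg eqxx in yx.
Qed.

Lemma gr_mul_singlel (R : pzRingType) (B : groupType) (u : group_ring R B)
  (k : R) (b x : B) : (gr_single k b * u)%R x = (k * u (b^-1 * x)%g)%R.
Proof.
have -> : (gr_single k b * u)%R x = gr_mul (gr_single k b) u x by [].
rewrite (@gr_mulE_in _ _ _ _ _ [fset b]%fset); last exact: finsupp_sub.
by rewrite big_seq_fset1 gr_singleE eqxx.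
Qed.

Section CyclicLamps.
Variables (A : finGroupType) (B : groupType) (a0 : A).
Hypothesis a0_gen : forall a : A, a \in <[a0]>.
Local Notation base := {fsfun B -> A with 1}.
Local Notation W := (wreath A B).
Local Notation ZA := (Zmodn #|A|).
Local Notation AB := (group_ring ZA B).

Let cardA : #|A|.-1.+1 = #[a0].
Proof.
rewrite prednK; last by apply/card_gt0P; exists a0.
by apply: eq_card => a; rewrite a0_gen.
Qed.

Let expg_modA m : a0 ^+ (m %% #|A|.-1.+1) = a0 ^+ m.
Proof. by rewrite cardA expg_mod_order. Qed.

Definition zexp (k : ZA) : A := a0 ^+ (k : 'I_(#|A|.-1.+1)).

Lemma zexp_bij : bijective zexp.
Proof.
have inj : injective (zexp : 'I_(#|A|.-1.+1) -> A).
  move=> k l /eqP; rewrite /zexp eq_expg_mod_order -cardA !modn_small //.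
  by move/eqP/val_inj.
apply: (inj_card_bij inj); rewrite card_ord.
by rewrite prednK //; apply/card_gt0P; exists a0.
Qed.

Lemma zexpD k l : zexp (k + l)%R = zexp k * zexp l.
Proof. by rewrite /zexp /= expg_modA expgD. Qed.

Lemma zexpM (k l : ZA) : zexp (k * l)%R = zexp k ^+ (l : 'I_(#|A|.-1.+1)).
Proof. by rewrite /zexp /= expg_modA expgM. Qed.

Lemma zexp1 : zexp 1%R = a0.
Proof. by rewrite /zexp /= expg_modA expg1. Qed.

Lemma zlog_ex : exists zlog : A -> ZA, cancel zexp zlog /\ cancel zlog zexp.
Proof. by case: zexp_bij => zlog zexpK zlogK; exists zlog. Qed.

Definition zlog : A -> ZA := projT1 (cid zlog_ex).

Lemma zexpK : cancel zexp zlog.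
Proof. by rewrite /zlog; case: cid => l []. Qed.

Lemma zlogK : cancel zlog zexp.
Proof. by rewrite /zlog; case: cid => l []. Qed.

Lemma zlog1 : zlog 1 = 0%R.
Proof. by rewrite -[RHS]zexpK. Qed.

Lemma zlogM a b : zlog (a * b) = (zlog a + zlog b)%R.
Proof. by rewrite -[RHS]zexpK zexpD !zlogK. Qed.

Lemma zlogX a (k : ZA) :
  zlog (a ^+ (k : 'I_(#|A|.-1.+1))) = (k * zlog a)%R.
Proof. by rewrite -[RHS]zexpK GRing.mulrC zexpM zlogK. Qed.

(** The discrete logarithm to the base [a0] identifies the multiplicatively
    written base with the free module of rank one over the group ring. *)
Definition gr_of (f : base) : AB := [fsfun x in finsupp f => zlog (f x) | 0%R].

Lemma gr_ofE f x : gr_of f x = zlog (f x).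
Proof. by rewrite fsfunE; case: finsuppP => //; rewrite zlog1. Qed.

Lemma gr_of1 : gr_of [fsfun with 1] = 0%R.
Proof. by apply: grP => x; rewrite gr_ofE base1E zlog1 gr_zeroE. Qed.

Lemma gr_ofM f g : gr_of (base_mul f g) = (gr_of f + gr_of g)%R.
Proof. by apply: grP => x; rewrite gr_addE !gr_ofE base_mulE zlogM. Qed.

Section FixCursor.
Variable phi : autgrp W.
Hypothesis phi_cursor : forall u, cursor (phi u) = cursor u.
Hypothesis phi_fix : forall b, phi (of_cursor A b) = of_cursor A b.

(** The image of the generator [1] of the free module of rank one:
    by [gr_of_aut], [phi] acts on the base as right multiplication by it. *)
Definition aut_unit : AB := gr_of (lamps (phi (of_base (toggle a0 1)))).

Lemma lamps_aut_baseM f g :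
  lamps (phi (of_base (base_mul f g))) =
  base_mul (lamps (phi (of_base f))) (lamps (phi (of_base g))).
Proof.
apply/fsfunP => x.
by rewrite of_baseM autM lampsM phi_cursor base_mulE invg1 mul1g.
Qed.

Lemma gr_of_aut_toggle a x :
  gr_of (lamps (phi (of_base (toggle a x)))) =
  (gr_of (toggle a x) * aut_unit)%R.
Proof.
have powE k y : lamps (phi (of_base (toggle (a0 ^+ k) 1))) y =
    lamps (phi (of_base (toggle a0 1))) y ^+ k.
  elim: k => [|k IHk].
    rewrite expg0 (_ : of_base _ = 1) ?aut1 ?lamps1 //.
    by apply: wreathP => // z; rewrite lamps1 toggleE; case: eqP.
  rewrite !expgS -IHk -base_mulE -lamps_aut_baseM; congr (lamps (phi _) _).
  apply: wreathP => // z; rewrite /= base_mulE !toggleE.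
  by case: eqP; rewrite ?mulg1.
apply: grP => y; rewrite gr_ofE.
have -> : gr_of (toggle a x) = gr_single (zlog a) x.
  by apply: grP => z; rewrite gr_ofE gr_singleE toggleE; case: eqP; rewrite ?zlog1.
rewrite gr_mul_singlel gr_ofE -zlogX -powE -/(zexp _) zlogK.
rewrite -{1}[x]mulg1 toggle_conj -of_cursorV !autM !phi_fix.
by rewrite !wreathE /= !(mul1g, invg1, mulg1).
Qed.

Lemma gr_of_aut f :
  gr_of (lamps (phi (of_base f))) = (gr_of f * aut_unit)%R.
Proof.
elim/base_ind: f => [|a x f IHf].
  rewrite gr_of1 GRing.mul0r (_ : phi _ = 1) ?gr_of1 //; exact: aut1.
by rewrite lamps_aut_baseM !gr_ofM IHf gr_of_aut_toggle GRing.mulrDl.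
Qed.

End FixCursor.

Lemma aut_unit_mulV (phi : autgrp W) :
  (forall u, cursor (phi u) = cursor u) ->
  (forall b, phi (of_cursor A b) = of_cursor A b) ->
  (forall u, cursor (phi^-1 u) = cursor u) ->
  (forall b, phi^-1 (of_cursor A b) = of_cursor A b) ->
  (aut_unit phi * aut_unit phi^-1%g = 1)%R.
Proof.
move=> phiC phiF phiVC phiVF.
rewrite -gr_of_aut // of_baseK ?phiC // autK; apply: grP => x.
rewrite gr_ofE gr_singleE toggleE; case: eqP => _; last exact: zlog1.
by rewrite -[a0 in LHS]zexp1 zexpK.
Qed.

(** Right multiplication by a trivial unit [k b] raises the lamps to the power
    [k] and translates them by [b] on the right.  The translation is the
    composite of conjugation by [b] in the wreath product, which translates on
    the left, with the automorphism of [B] that undoes it on cursors. *)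
Lemma kaplansky_aut (phi : autgrp W) : kaplansky_unit ZA B ->
  (forall u, cursor (phi u) = cursor u) ->
  (forall b, phi (of_cursor A b) = of_cursor A b) ->
  exists (al : autgrp A) (b : B),
    phi = inner_aut (of_cursor A b) * wreath_aut al (inner_aut b^-1).
Proof.
move=> kap phiC phiF.
have phiVC u : cursor (phi^-1 u) = cursor u by rewrite -phiC autVK.
have phiVF b : phi^-1 (of_cursor A b) = of_cursor A b by rewrite -{1}phiF autK.
have [|k [b [_ unitE]]] := kap (aut_unit phi).
  exists (aut_unit phi^-1); split; first exact: aut_unit_mulV.
  by rewrite -{2}[phi]invgK; apply: aut_unit_mulV; rewrite ?invgK.
have phiE f x : lamps (phi (of_base f)) x = f (x * b^-1) ^+ (k : 'I_(#|A|.-1.+1)).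
  apply: (can_inj zlogK); rewrite zlogX -!gr_ofE gr_of_aut // unitE.
  by rewrite gr_mul_singler GRing.mulrC.
have al_aut : is_aut (fun a : A => a ^+ (k : 'I_(#|A|.-1.+1))).
  split=> [x y|].
    apply: expgMn; have /cycleP[i ->] := a0_gen x; have /cycleP[j ->] := a0_gen y.
    by apply: commuteX2.
  apply: injF_bij => x y xy.
  have /(congr1 (fun u : W => lamps u 1)) : of_base (toggle x (1 : B)) = of_base (toggle y 1).
    apply: (bij_inj (aut_bij phi)); apply: wreathP => [z|]; last by rewrite !phiC.
    by rewrite !phiE !toggleE; case: eqP => // _.
  by rewrite /= !toggleE eqxx.
exists (mk_aut al_aut), b; apply: autP => u.
rewrite autME {1}[u]wreath_decomp autM phiF; apply: wreathP => [x|].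
  rewrite lampsM phiC phiE [inner_aut _ _]/= !wreathE /= !(mul1g, invg1, mulg1).
  by rewrite base_mapE inner_autV invgK /= mulVKg.
by rewrite !wreathE phiC /= mul1g invgK !mulgA mulgV mul1g mulgK.
Qed.

End CyclicLamps.

(** * Outer automorphisms *)

(** Every automorphism preserves the base, hence induces some [be] on [B].
    After division by the lift of [be] it maps the copy of [B] to another
    complement of the base, conjugate to the first one as [B] is one-ended.
    After division by this conjugation the rest is a module automorphism of
    the base. *)
Lemma out_wreath_aut (A : finGroupType) (B : groupType) :
  cyclic [set: A]%SET -> one_ended B -> kaplansky_unit (Zmodn #|A|) B ->
  forall phi : autgrp (wreath A B), exists (al : autgrp A) (be : autgrp B),
    out phi = out (wreath_aut al be).
Proof.
move=> /cyclicP[a0 a0E] endB kap phi.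
have a0_gen a : a \in <[a0]> by rewrite -a0E inE.
have mulAC : commutative (fun a b : A => a * b).
  move=> a b; have /cycleP[i ->] := a0_gen a; have /cycleP[j ->] := a0_gen b.
  by apply: commuteX2.
have baseC (f : autgrp (wreath A B)) u : cursor u = 1 -> cursor (f u) = 1.
  exact: base_characteristic mulAC f u (one_ended_infinite endB).
have cursorE (f : autgrp (wreath A B)) u :
    cursor (f u) = cursor (f (of_cursor A (cursor u))).
  by rewrite {1}[u]wreath_decomp autM cursorM baseC ?mul1g.
have be_aut : is_aut (fun b => cursor (phi (of_cursor A b))).
  split=> [b c|]; first by rewrite of_cursorM autM.
  exists (fun b => cursor (phi^-1 (of_cursor A b))) => b.
    by rewrite -cursorE autK.
  by rewrite -cursorE autVK.
pose be := mk_aut be_aut; pose phi1 := phi * (wreath_aut 1 be)^-1.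
have phi1C u : cursor (phi1 u) = cursor u.
  rewrite autME cursorE; exact: congr1 (autVK (wreath_aut 1 be) u).
have [|b|f phi1E] := section_conjugate (sigma := fun b => phi1 (of_cursor A b)) endB.
- by move=> b c; rewrite of_cursorM autM.
- by rewrite phi1C.
pose phi2 := (inner_aut (of_base f))^-1 * phi1.
have [u|b|al [b phi2E]] := kaplansky_aut a0_gen (phi := phi2) kap.
- rewrite autME -inner_autV.
  transitivity (1^-1 * cursor (phi1 u) * 1^-1^-1) => //.
  by rewrite phi1C !(mul1g, invg1, mulg1).
- by rewrite autME phi1E -inner_autV /= invgK !mulgA mulVg mul1g mulgVK.
exists al, (inner_aut b^-1 * be).
have -> : phi = inner_aut (of_base f) * phi2 * wreath_aut 1 be.
  by rewrite /phi2 mulVKg mulgVK.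
rewrite phi2E -[al]mulg1 wreath_autM !outM !out_inner_aut !mul1g.
by rewrite mulg1.
Qed.

Lemma finite_autgrp (A : finGroupType) : finite_set [set: autgrp A].
Proof.
have -> : [set: autgrp A] = (fun f : autgrp A => [ffun a => f a]) @^-1` setT by [].
apply: finite_preimage; last exact: finite_finset.
by move=> f g _ _ /ffunP fg; apply: autP => a; have := fg a; rewrite !ffunE.
Qed.

Local Close Scope classical_set_scope.

Theorem corollary1p9 (A : finGroupType) (B : groupType) :
  cyclic [set: A] ->
  one_ended B ->
  finitely_presented B ->
  finitely_generated (autgrp B) ->
  kaplansky_unit (Zmodn #|A|) B ->
  finitely_generated (outgrp (wreath A B)).
Proof.
move=> cycA endB _ [S finS genS] kap.
pose lampT := range (fun al : autgrp A => out (wreath_aut al (1 : autgrp B))).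
pose curT := ((fun be => out (wreath_aut (1 : autgrp A) be)) @` S)%classic.
exists (lampT `|` curT)%classic.
  rewrite finite_setU; split; apply: finite_image => //; exact: finite_autgrp.
set T := (_ `|` _)%classic.
rewrite -subTset => x _ P [sgP TP].
have [P1 PV] := sgP.
have PM y z : P y -> P z -> P (y * z).
  move=> Py Pz; rewrite -[z]invgK; apply: (PV) => //.
  by rewrite -[z^-1]mul1g; apply: (PV).
have [phi ->] := cls_surj x.
have [al [be]] := out_wreath_aut cycA endB kap phi; rewrite /out => ->.
rewrite -[al]mulg1 -[be]mul1g wreath_autM -/(out _) outM.
apply: PM; first by apply: TP; left; exists al.
apply: (generation_ind genS (H := fun b => P (out (wreath_aut 1 b)))).
  split=> [|b c Pb Pc]; first by rewrite wreath_aut1.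
  have -> : out (wreath_aut (1 : autgrp A) (b * c^-1)) =
      out (wreath_aut 1 b) * (out (wreath_aut 1 c))^-1; last exact: (PV _ _ Pb Pc).
    apply: (@mulIg _ (out (wreath_aut 1 c))).
    by rewrite mulgVK -outM -wreath_autM mulg1 mulgVK.
by move=> b Sb; apply: TP; right; exists b.
Qed.
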